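(* Let $\mathfrak K$ be a planar covering complex with covering $\boldsymbol A(\mathfrak K)=\mathfrak M^*$ and principal group $\mathfrak V$ with generators $S_1,\dots,S_r$ and defining relations ${R_i^*}^{k_i}(S)=1$; let $\mathfrak U$ be a subgroup of $\mathfrak V$ and $\boldsymbol A'(\mathfrak K)=\mathfrak M$ the regular covering belonging to $\mathfrak U$. Let $R^k$ be one of the relations ${R_i^*}^{k_i}$ (so $R=R_i^*$, $k=k_i$) and let $V$ be an element of $\mathfrak V$. If $l$ is the smallest positive integer with $\mathfrak U V R^l=\mathfrak U V$, then $l$ divides $k$, and, if $k=lm$, the boundary path in $\mathfrak K$ which begins at the point $V$ and corresponds to the word $R^k$ covers a boundary path in $\mathfrak M$ with branching order $m-1$.
   Context: A line segment complex consists of points and directed segments; each segment $s$ has an initial and a final point and an oppositely directed segment $s^{-1}\ne s$, $(s^{-1})^{-1}=s$, with initial and final point exchanged. A surface complex is a line segment complex together with surface pieces $f$; each $f$ has an opposite $f^{-1}\neq f$, $(f^{-1})^{-1}=f$, and a closed path, determined up to cyclic interchange, circumscribing $f$ once positively (a simple positive boundary path of $f$); if $w$ is one for $f$, then $w^{-1}$ is one for $f^{-1}$. A manifold is a surface complex such that: (1) the line segment complex is connected; (2) every segment occurs in the boundary of some surface piece; (3) a simple boundary path runs through a segment (in either direction) at most twice; if the boundary path of $f$ runs through $s$ once, there is, up to orientation, exactly one surface piece $f'\neq f^{\pm1}$ whose boundary runs through $s$, and it does so once; if twice, $s$ bounds only $f^{\pm1}$; (4) at every point $p$, any two segments beginning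 at $p$ can be joined by a sequence of segments $s_1,\dots,s_m$ beginning at $p$ such that $s_i^{-1}s_{i+1}$ is a (cyclic) subpath of a boundary path, and $s_{i-1},s_{i+1}$ come from the two different passages of boundary paths through $s_i$. It is oriented if one piece of each pair $f^{\pm1}$ is chosen so that the simple positive boundary paths of the chosen pieces together run through each segment once in each direction. Covering (possibly branched) $\boldsymbol A(\mathfrak C)=\mathfrak C^*$ of surface complexes: a map of points, segments, surface pieces, surjective on points, such that (a) initial points are preserved, $\boldsymbol A(s^{-1})=\boldsymbol A(s)^{-1}$, $\boldsymbol A(f^{-1})=\boldsymbol A(f)^{-1}$, and the segments beginning at $p$ are mapped bijectively onto those beginning at $\boldsymbol A(p)$; (b) if $r$ is a simple positive boundary path of $f$, then $\boldsymbol A(r)={r^*}^k$ for a simple positive boundary path $r^*$ of $\boldsymbol A(f)$, and, writing $r=w_1\cdots w_k$ with $\boldsymbol A(w_i)=r^*$, the $w_i$ are pairwise distinct; (c) if $r^*$ is a simple positive boundary path of $f^*$ and $w'$ is a path with $\boldsymbol A(w')=r^*$, there is exactly one surface piece $f'$ over $f^*$ in whose simple positive boundary path $r'$ (suitably cyclically interchanged) $w'$ occurs as initial subpath. If $\boldsymbol A(r')={r^*}^k$, then $k-1$ is the branching number of $f'$, and we say that the boundary path of $f'$ covers $r^*$ with branching order $k-1$. Planar covering complex: $\mathfrak M^*$ is an oriented manifold with a single point, segments $s_1^{*\pm1},\dots,s_r^{*\pm1}$ and surface pieces $f_i^*$ with simple positive boundary paths $R_i^*(s^* )$, regularly covered by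 a connected manifold $\mathfrak M_0$ (regular: if two paths have the same image and one is closed, so is the other), the pieces over $f_i^*$ having branching number $k_i-1$; $\mathfrak K$ is the universal covering complex of $\mathfrak M_0$, i.e. the connected unbranched covering complex in which a path is closed iff its image in $\mathfrak M_0$ is closed and represents the identity of the fundamental group of $\mathfrak M_0$ (closed paths modulo insertion and deletion of $ss^{-1}$ and of boundary paths of surface pieces). $\boldsymbol A(\mathfrak K)=\mathfrak M^*$ is the composite. The principal group is $\mathfrak V=\langle S_1,\dots,S_r\mid R_i^*(S)^{k_i}\rangle$, and the line segment complex of $\mathfrak K$ is its group diagram: its points are the elements $V$ of $\mathfrak V$, and the segment over $s_i^*$ beginning at $V$ ends at $VS_i$. $\mathfrak V$ acts on $\mathfrak K$ by left multiplication. For a subgroup $\mathfrak U$, $\boldsymbol A'(\mathfrak K)=\mathfrak M$ is the regular covering for which two elements (points, segments, surface pieces) of $\mathfrak K$ lie over the same element of $\mathfrak M$ iff they can be carried into each other by a transformation from $\mathfrak U$.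
   Formalization: The covering complex 𝔐 belonging to 𝔘 is required to be a manifold; the orbit condition alone does not determine its boundary paths (they could wrap several times), and the claimed branching order would then fail. *)

(* Defs.v *)
From mathcomp Require Import all_boot.
From mathcomp Require Import classical_sets.

Set Implicit Arguments.
Unset Strict Implicit.
Unset Printing Implicit Defensive.

Local Open Scope classical_set_scope.

Definition pow (T : Type) (w : seq T) (k : nat) : seq T := flatten (nseq k w).

(* [path_from ini ter p w q]: the segments of w form a path from p to q; the
   empty path is allowed at every point. *)
Fixpoint path_from (P S : Type) (ini ter : S -> P) (p : P) (w : seq S) (q : P)
    : Prop :=
  if w is s :: w' then ini s = p /\ path_from ini ter (ter s) w' q else p = q.

(* A boundary path is determined only up to cyclic interchange; [bd f] is a
   chosen representative, and the simple positive boundary paths of f are its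
   rotations, see [sbp] below.  The representatives are chosen so that
   [bd (finv f)] is exactly the inverse of [bd f], so that position j of [bd f]
   and position n - 1 - j of [bd (finv f)], with n their common length, are the
   same passage traversed in opposite directions.  Boundary paths contain at
   least one segment. *)
Record surfaceComplex : Type := SurfaceComplex {
  point : Type;
  seg : eqType;
  piece : eqType;
  ini : seg -> point;
  sinv : seg -> seg;
  finv : piece -> piece;
  bd : piece -> seq seg;
  sinvK : involutive sinv;
  sinv_neq : forall s, sinv s <> s;
  finvK : involutive finv;
  finv_neq : forall f, finv f <> f;
  bd_neq0 : forall f, bd f <> [::];
  bd_closed :
    forall f, exists p, path_from ini (fun s => ini (sinv s)) p (bd f) p;
  bd_finv : forall f, bd (finv f) = rev (map sinv (bd f)) }.

Arguments ini {_}.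
Arguments sinv {_}.
Arguments finv {_}.
Arguments bd {_}.

Definition ter (K : surfaceComplex) (s : seg K) : point K := ini (sinv s).

Definition is_path (K : surfaceComplex) (p : point K) (w : seq (seg K))
    (q : point K) : Prop := path_from ini (@ter K) p w q.

(* r is a simple positive boundary path of f *)
Definition sbp (K : surfaceComplex) (f : piece K) (r : seq (seg K)) : Prop :=
  exists n, r = rot n (bd f).

Definition connected (K : surfaceComplex) : Prop :=
  forall p q : point K, exists w, is_path p w q.

(* number of times w runs through s, in either direction *)
Definition runs (K : surfaceComplex) (s : seg K) (w : seq (seg K)) : nat :=
  count (fun t => (t == s) || (t == sinv s)) w.

(* A passage (f, j) is the j-th step of the boundary path of f. *)
Definition passage (K : surfaceComplex) : Type := (piece K * nat)%type.

Definition passage_seg (K : surfaceComplex) (c : passage K) : option (seg K) :=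
  onth (bd c.1) c.2.

Definition next_passage (K : surfaceComplex) (c : passage K) : passage K :=
  (c.1, c.2.+1 %% size (bd c.1)).

Definition opp_passage (K : surfaceComplex) (c : passage K) : passage K :=
  (finv c.1, size (bd c.1) - c.2.+1).

(* [fan s c t]: there are segments s = s_1, ..., s_m = t with m > 1 such that
   each s_i^-1 s_(i+1) is a cyclic subpath of a boundary path, c being the
   passage through s_m so reached.  The condition [d <> opp_passage c] says
   that s_(i-1) and s_(i+1) come from different passages through s_i: the
   passage c runs through s_i and d through s_i^-1, so they are the same
   unoriented passage exactly when d is the opposite of c. *)
Inductive fan (K : surfaceComplex) (s : seg K) : passage K -> seg K -> Prop :=
| fan_one c t :
    passage_seg c = Some (sinv s) -> passage_seg (next_passage c) = Some t ->
    fan s (next_passage c) t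
| fan_step c t d u :
    fan s c t -> passage_seg d = Some (sinv t) ->
    passage_seg (next_passage d) = Some u -> d <> opp_passage c ->
    fan s (next_passage d) u.

Record manifold (K : surfaceComplex) : Prop := Manifold {
  manifold_connected : connected K;
  manifold_bounded : forall s : seg K, exists f, 0 < runs s (bd f);
  manifold_le2 : forall (s : seg K) f, runs s (bd f) <= 2;
  manifold_once : forall (s : seg K) f, runs s (bd f) = 1 ->
    exists f', [/\ f' <> f, f' <> finv f, runs s (bd f') = 1
      & forall g, 0 < runs s (bd g) ->
          [\/ g = f, g = finv f, g = f' | g = finv f']];
  manifold_twice : forall (s : seg K) f, runs s (bd f) = 2 ->
    forall g, 0 < runs s (bd g) -> g = f \/ g = finv f;
  manifold_fan : forall s t : seg K, ini s = ini t ->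
    s = t \/ exists c, fan s c t }.

(* s ranges over directed segments, so each is run through once in each
   direction. *)
Definition orientation (K : surfaceComplex) (pos : piece K -> Prop) : Prop :=
  (forall f, pos (finv f) <-> ~ pos f) /\
  (forall s : seg K, exists! c : passage K, pos c.1 /\ passage_seg c = Some s).

Record cmap (K L : surfaceComplex) : Type := CMap {
  onP : point K -> point L;
  onS : seg K -> seg L;
  onF : piece K -> piece L }.

Definition ccomp (K L N : surfaceComplex) (B : cmap L N) (A : cmap K L)
    : cmap K N :=
  CMap (fun p => onP B (onP A p)) (fun s => onS B (onS A s))
       (fun f => onF B (onF A f)).

Record covering (K L : surfaceComplex) (A : cmap K L) : Prop := Covering {
  cov_surj : forall q, exists p, onP A p = q;
  cov_ini : forall s, ini (onS A s) = onP A (ini s);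
  cov_sinv : forall s, onS A (sinv s) = sinv (onS A s);
  cov_finv : forall f, onF A (finv f) = finv (onF A f);
  cov_star : forall p t, ini t = onP A p ->
    exists! s, ini s = p /\ onS A s = t;
  (* ws lists the subpaths w_1, ..., w_k *)
  cov_bd : forall f r, sbp f r -> exists rs ws,
    [/\ sbp (onF A f) rs, map (onS A) r = pow rs (size ws),
        r = flatten ws, (forall w, w \in ws -> map (onS A) w = rs) & uniq ws];
  cov_lift : forall fs rs p w q, sbp fs rs -> is_path p w q ->
    map (onS A) w = rs ->
    exists! f, onF A f = fs /\ exists r, sbp f r /\ prefix w r }.

(* r is a boundary path of f which covers the boundary path rs of A(f) with
   branching order b *)
Definition covers_with_order (K L : surfaceComplex) (A : cmap K L)
    (f : piece K) (r : seq (seg K)) (rs : seq (seg L)) (b : nat) : Prop :=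
  [/\ sbp f r, sbp (onF A f) rs & map (onS A) r = pow rs b.+1].

Definition branching_number (K L : surfaceComplex) (A : cmap K L)
    (f : piece K) (b : nat) : Prop :=
  exists r rs, covers_with_order A f r rs b.

Definition unbranched (K L : surfaceComplex) (A : cmap K L) : Prop :=
  forall f, branching_number A f 0.

Definition regular (K L : surfaceComplex) (A : cmap K L) : Prop :=
  forall p w q p' w' q', is_path p w q -> is_path p' w' q' ->
    onP A p = onP A p' -> map (onS A) w = map (onS A) w' ->
    p = q -> p' = q'.

(* One elementary insertion in a path starting at p.  As w1 ++ w2 is a path,
   the side condition makes the inserted piece a closed path. *)
Inductive insertion (K : surfaceComplex) (p : point K)
    : seq (seg K) -> seq (seg K) -> Prop :=
| insertion_seg w1 w2 s q :
    is_path p (w1 ++ w2) q -> is_path p (w1 ++ [:: s; sinv s] ++ w2) q ->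
    insertion p (w1 ++ w2) (w1 ++ [:: s; sinv s] ++ w2)
| insertion_bd w1 w2 f r q :
    is_path p (w1 ++ w2) q -> sbp f r -> is_path p (w1 ++ r ++ w2) q ->
    insertion p (w1 ++ w2) (w1 ++ r ++ w2).

Inductive homotopic (K : surfaceComplex) (p : point K)
    : seq (seg K) -> seq (seg K) -> Prop :=
| homotopic_refl w : homotopic p w w
| homotopic_ins w w' w'' :
    insertion p w w' -> homotopic p w' w'' -> homotopic p w w''
| homotopic_del w w' w'' :
    insertion p w' w -> homotopic p w' w'' -> homotopic p w w''.

Definition universal_covering (K L : surfaceComplex) (A : cmap K L) : Prop :=
  [/\ covering A, connected K, unbranched A
    & forall p w q, is_path p w q ->
        (p = q <-> onP A p = onP A q /\
                   homotopic (onP A p) (map (onS A) w) [::])].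

(* The letter (i, false) stands for the generator S_i, and (i, true) for its
   inverse. *)
Definition word (n : nat) : Type := seq ('I_n * bool).

Definition letter (n : nat) (T : Type) (inv : T -> T) (g : 'I_n -> T)
    (x : 'I_n * bool) : T := if x.2 then inv (g x.1) else g x.1.

Definition eval (G : groupType) (n : nat) (S : 'I_n -> G) (w : word n) : G :=
  (\prod_(x <- w) letter (fun g => g^-1) S x)%g.

Inductive word_equiv (n : nat) (rel : word n -> Prop)
    : word n -> word n -> Prop :=
| word_equiv_refl w : word_equiv rel w w
| word_equiv_sym w w' : word_equiv rel w w' -> word_equiv rel w' w
| word_equiv_trans w w' w'' :
    word_equiv rel w w' -> word_equiv rel w' w'' -> word_equiv rel w w''
| word_equiv_cancel w1 w2 x :
    word_equiv rel (w1 ++ w2) (w1 ++ [:: x; (x.1, ~~ x.2)] ++ w2)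
| word_equiv_rel w1 w2 r :
    rel r -> word_equiv rel (w1 ++ w2) (w1 ++ r ++ w2).

(* G is the group with generators S_1, ..., S_n and defining relations
   r = 1 for the words r satisfying rel *)
Definition presentation (G : groupType) (n : nat) (S : 'I_n -> G)
    (rel : word n -> Prop) : Prop :=
  (forall g, exists w, eval S w = g) /\
  (forall w w', eval S w = eval S w' <-> word_equiv rel w w').

Record planarCovering : Type := PlanarCovering {
  base : surfaceComplex;
  base_manifold : manifold base;
  base_pos : piece base -> Prop;
  base_oriented : orientation base_pos;
  base_point : exists p : point base, forall q, q = p;
  rank : nat;
  base_seg : 'I_rank -> seg base;
  base_segP : bijective (letter sinv base_seg);
  nrel : nat;
  base_piece : 'I_nrel -> piece base;
  base_piece_inj : injective base_piece;
  base_pieceP : forall f, base_pos f <-> exists i, f = base_piece i;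
  relator : 'I_nrel -> word rank;
  relatorP : forall i,
    sbp (base_piece i) (map (letter sinv base_seg) (relator i));
  mid : surfaceComplex;
  mid_manifold : manifold mid;
  mid_cov : cmap mid base;
  mid_covering : covering mid_cov;
  mid_regular : regular mid_cov;
  mult : 'I_nrel -> nat;
  mult_gt0 : forall i, 0 < mult i;
  mid_branching : forall i f, onF mid_cov f = base_piece i ->
    branching_number mid_cov f (mult i).-1;
  univ : surfaceComplex;
  univ_cov : cmap univ mid;
  univ_universal : universal_covering univ_cov;
  (* The line segment complex of [univ] is the group diagram of the principal
     group: [vertex] identifies the elements of the group with the points. *)
  principal : groupType;
  gen : 'I_rank -> principal;
  principalP :
    presentation gen (fun w => exists i, w = pow (relator i) (mult i));
  vertex : principal -> point univ;
  vertex_bij : bijective vertex;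
  vertexP : forall v i s, ini s = vertex v ->
    onS mid_cov (onS univ_cov s) = base_seg i -> ter s = vertex (v * gen i)%g }.

Definition total_cov (X : planarCovering) : cmap (univ X) (base X) :=
  ccomp (mid_cov X) (univ_cov X).

Record automorphism (K : surfaceComplex) (g : cmap K K) : Prop :=
  Automorphism {
  aut_bijP : bijective (onP g);
  aut_bijS : bijective (onS g);
  aut_bijF : bijective (onF g);
  aut_ini : forall s, ini (onS g s) = onP g (ini s);
  aut_sinv : forall s, onS g (sinv s) = sinv (onS g s);
  aut_finv : forall f, onF g (finv f) = finv (onF g f);
  aut_sbp : forall f r, sbp f r -> sbp (onF g f) (map (onS g) r) }.

(* g is the left multiplication by u.  It carries each segment and each piece
   to one over the same element of the base.  For pieces this has to be said
   explicitly, as two pieces over different elements of the base may have the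
   same boundary paths. *)
Definition left_translation (X : planarCovering) (u : principal X)
    (g : cmap (univ X) (univ X)) : Prop :=
  [/\ automorphism g,
      forall v, onP g (vertex v) = vertex (u * v)%g,
      forall s, onS (total_cov X) (onS g s) = onS (total_cov X) s
    & forall f, onF (total_cov X) (onF g f) = onF (total_cov X) f].

Definition is_subgroup (G : groupType) (U : set G) : Prop :=
  U 1%g /\ forall u v, U u -> U v -> U (u / v)%g.

Definition right_coset (G : groupType) (U : set G) (v : G) : set G :=
  [set (u * v)%g | u in U].

(* A is the covering with the given fibres whose image M is again a manifold.
   The fibres alone would not determine the pieces of M: if the stabilizer of a
   piece f in U is nontrivial, one could let the boundary path of A(f) run
   several times around the closed path which it should run around once; then M
   would be a surface complex, but not a manifold. *)
Definition belongs_to (X : planarCovering) (U : set (principal X))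
    (M : surfaceComplex) (A : cmap (univ X) M) : Prop :=
  let U_translation g := exists2 u, U u & left_translation u g in
  [/\ manifold M, covering A /\ regular A,
      forall p q, onP A p = onP A q <->
        exists2 g, U_translation g & onP g p = q,
      forall s t, onS A s = onS A t <->
        exists2 g, U_translation g & onS g s = t
    & forall f h, onF A f = onF A h <->
        exists2 g, U_translation g & onF g f = h].

(* r is the path beginning at p which corresponds to the word w *)
Definition spells (X : planarCovering) (p : point (univ X))
    (w : word (rank X)) (r : seq (seg (univ X))) : Prop :=
  (exists q, is_path p r q) /\
  map (onS (total_cov X)) r = map (letter sinv (@base_seg X)) w.

(* Main.v *)
Require Import Defs.
From mathcomp Require Import all_boot classical_sets.
From mathcomp Require boolp.

Set Implicit Arguments.
Unset Strict Implicit.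
Unset Printing Implicit Defensive.

(** Let r be the path of K which begins at the point v and spells R^k, and let f
    be the piece which it bounds.  Its image in M is rs^b for a simple boundary
    path rs of the image of f, and rs has some length j * n, where n is the length
    of the word R; the claim is j = l, for then b = m.  In fact only the initial
    segment r_0 of r has to be compared with later segments of r.

    - U contains v R^j v^-1, so l <= j: the segments r_0 and r_(jn) have the same
      image in M, hence are carried into each other by a translation from U, and
      their initial points are v and v R^j.  That the length of rs is a multiple
      of n comes from the same translation: it preserves the segment of the base
      below, and R runs through no directed segment twice, because the base is
      oriented ([orientation_uniq]).

    - l < j is impossible: the left translation by v R^l v^-1, an element of U,
      carries r_0 to r_(ln), so rs would run twice through the image of r_0 in the
      same direction.  Since M inherits an orientation from the base and is a
      manifold, this cannot happen ([quotient_boundary_uniq]).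

    Two constructions support this.  A piece of K is determined by the base piece
    below it and by one of its boundary paths, and every path with the right
    projection bounds such a piece ([total_piece]); this yields f, and it also
    shows that left multiplication by an element of the principal group extends
    from the points to an automorphism of K ([left_translation_ex]).  Finally,
    l divides k because R^k = 1 ([subgroup_period]). *)

(** * Words, paths and boundary paths *)

Lemma size_pow (T : Type) (w : seq T) k : size (pow w k) = k * size w.
Proof. by elim: k => //= k IH; rewrite size_cat -/(pow w k) IH mulSn. Qed.

Lemma powD (T : Type) (w : seq T) j k : pow w (j + k) = pow w j ++ pow w k.
Proof. by rewrite /pow nseqD flatten_cat. Qed.

Lemma pow_split (T : Type) (w : seq T) j k :
  j <= k -> pow w k = pow w j ++ pow w (k - j).
Proof. by move=> le_jk; rewrite -powD subnKC. Qed.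

Lemma map_pow (T T' : Type) (h : T -> T') w k :
  map h (pow w k) = pow (map h w) k.
Proof. by elim: k => //= k IH; rewrite map_cat -/(pow w k) IH. Qed.

Lemma nth_pow (T : Type) (x0 : T) w k j :
  j < k * size w -> nth x0 (pow w k) j = nth x0 w (j %% size w).
Proof.
elim: k j => // k IH j lt_j.
rewrite [pow w k.+1]/(w ++ pow w k) nth_cat.
case: ltnP => [lt_jw | le_wj]; first by rewrite modn_small.
by rewrite IH ?ltn_subLR -?mulSn // -{2}(subnK le_wj) modnDr.
Qed.

Lemma eval_cat (G : groupType) n (S : 'I_n -> G) w w' :
  eval S (w ++ w') = (eval S w * eval S w')%g.
Proof. exact: big_cat. Qed.

Lemma eval_pow (G : groupType) n (S : 'I_n -> G) w k :
  eval S (pow w k) = (eval S w ^+ k)%g.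
Proof.
elim: k => [|k IH]; first by rewrite /eval big_nil expg0.
by rewrite expgS -IH -eval_cat.
Qed.

Lemma is_path_cat (K : surfaceComplex) (p q : Defs.point K) w w' :
  is_path p (w ++ w') q <-> exists m, is_path p w m /\ is_path m w' q.
Proof.
elim: w p => [|s w IH] p /=.
  by split=> [Pw' | [m [/= -> //]]]; exists p.
split=> [[ps /IH [m [Pw Pw']]] | [m [[ps Pw] Pw']]]; first by exists m.
by split=> //; apply/IH; exists m.
Qed.

Lemma is_path_ini (K : surfaceComplex) (p q : Defs.point K) s w :
  is_path p (s :: w) q -> ini s = p.
Proof. by case. Qed.

Lemma size_sbp (K : surfaceComplex) (f : piece K) r :
  sbp f r -> size r = size (bd f).
Proof. by case=> n ->; rewrite size_rot. Qed.

Lemma size_bd_gt0 (K : surfaceComplex) (f : piece K) : 0 < size (bd f).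
Proof. by have := @bd_neq0 K f; case: (bd f). Qed.

Lemma mem_sbp (K : surfaceComplex) (f : piece K) r :
  sbp f r -> r =i bd f.
Proof. by case=> n -> s; rewrite mem_rot. Qed.

Lemma sbp_bd (K : surfaceComplex) (f : piece K) : sbp f (bd f).
Proof. by exists 0; rewrite rot0. Qed.

Lemma sbp_rot (K : surfaceComplex) (f : piece K) n r :
  sbp f r -> sbp f (rot n r).
Proof.
case=> m ->; case: (leqP n (size (bd f))) => [len | /ltnW ltn]; last first.
  by exists m; rewrite rot_oversize ?size_rot.
case: (leqP m (size (bd f))) => [lem | /ltnW ltm]; last first.
  by exists n; rewrite (rot_oversize ltm).
by exists (if n + m <= size (bd f) then n + m else n + m - size (bd f));
  rewrite rot_add_mod.
Qed.

Lemma sbp_closed (K : surfaceComplex) (f : piece K) r :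
  sbp f r -> exists p, is_path p r p.
Proof.
case=> n ->; case: (bd_closed f) => p.
rewrite -{1}(cat_take_drop n (bd f)) => /is_path_cat [m [P1 P2]].
by exists m; apply/is_path_cat; exists p.
Qed.

Lemma sbp_finv (K : surfaceComplex) (f : piece K) r :
  sbp f r -> sbp (Defs.finv f) (rev (map sinv r)).
Proof.
case=> n ->; rewrite map_rot rev_rot.
rewrite -(bd_finv f) /rotr; exact: sbp_rot (sbp_bd _).
Qed.

(** * Coverings as maps of line segment complexes *)

(** What a covering does to the line segment complex.  Unlike the condition on
    boundary paths in [covering], this is evidently stable under composition, and
    it suffices for lifting paths uniquely. *)
Definition star_bijective (K L : surfaceComplex) (A : cmap K L) : Prop :=
  [/\ forall s, ini (onS A s) = onP A (ini s),
      forall s, onS A (sinv s) = sinv (onS A s)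
    & forall p t, ini t = onP A p -> exists! s, ini s = p /\ onS A s = t].

Lemma covering_star (K L : surfaceComplex) (A : cmap K L) :
  covering A -> star_bijective A.
Proof. by case. Qed.

Lemma ccomp_star (K L N : surfaceComplex) (B : cmap L N) (A : cmap K L) :
  star_bijective B -> star_bijective A -> star_bijective (ccomp B A).
Proof.
move=> [iniB invB starB] [iniA invA starA]; split=> [s|s|p t pt] /=.
- by rewrite iniB iniA.
- by rewrite invA invB.
have [s' [[ps' s't] uniq_s']] := starB _ _ pt.
have [s [[ps ss'] uniq_s]] := starA _ _ ps'.
exists s; split=> [|x [px xt]]; first by rewrite ss'.
by apply: uniq_s; split=> //; apply/esym/uniq_s'; rewrite iniA px.
Qed.

Lemma star_inj (K L : surfaceComplex) (A : cmap K L) s t :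
  star_bijective A -> ini s = ini t -> onS A s = onS A t -> s = t.
Proof.
move=> [iniA _ starA] st Ast.
have [x [_ uniq_x]] := starA (ini s) (onS A s) (iniA s).
by rewrite -(uniq_x s) // -(uniq_x t).
Qed.

Lemma star_ter (K L : surfaceComplex) (A : cmap K L) s :
  star_bijective A -> ter (onS A s) = onP A (ter s).
Proof. by case=> iniA invA _; rewrite /ter -invA iniA. Qed.

Lemma star_path (K L : surfaceComplex) (A : cmap K L) p w q :
  star_bijective A -> is_path p w q ->
  is_path (onP A p) (map (onS A) w) (onP A q).
Proof.
move=> starA; elim: w p => [|s w IH] p /=; first by move=> ->.
case=> <- /IH Pw; split; first by case: starA.
by rewrite star_ter.
Qed.

Lemma star_path_inj (K L : surfaceComplex) (A : cmap K L) p w q w' q' :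
  star_bijective A -> is_path p w q -> is_path p w' q' ->
  map (onS A) w = map (onS A) w' -> w = w'.
Proof.
move=> starA; elim: w p w' => [|s w IH] p [|s' w'] //= [ps Pw] [ps' Pw'].
case=> ss' ww'; have ess' : s = s' by apply: star_inj ss'; rewrite // ps.
by rewrite -ess' in Pw' *; congr (_ :: _); apply: IH Pw Pw' ww'.
Qed.

Lemma star_path_lift (K L : surfaceComplex) (A : cmap K L) p w q :
  star_bijective A -> is_path (onP A p) w q ->
  exists w' q', is_path p w' q' /\ map (onS A) w' = w.
Proof.
move=> starA; elim: w p => [|t w IH] p /=; first by exists [::], p.
case=> pt Pw; have [_ _ /(_ _ _ pt)[s [[ps st] _]]] := starA.
have [|w' [q' [Pw' w'w]]] := IH (ter s); first by rewrite -star_ter // st.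
by exists (s :: w'), q'; rewrite /= st w'w.
Qed.

(** * Branching *)

(** The power to which a boundary path is wrapped can be read off from the lengths
    of the boundary paths, so every boundary path of [f] gives the same one. *)
Lemma covering_boundary (K L : surfaceComplex) (A : cmap K L) f r k :
  covering A -> sbp f r -> size (bd f) = k * size (bd (onF A f)) ->
  exists rs, sbp (onF A f) rs /\ map (onS A) r = pow rs k.
Proof.
move=> covA fr sz; have [rs [ws [rsP rE _ _ _]]] := cov_bd covA fr.
exists rs; split=> //; rewrite rE; congr (pow _ _).
have /eqP := congr1 size rE.
rewrite size_pow size_map (size_sbp fr) (size_sbp rsP) sz eqn_pmul2r //.
  by move/eqP.
exact: size_bd_gt0.
Qed.

Lemma branching_size (K L : surfaceComplex) (A : cmap K L) f b :
  branching_number A f b -> size (bd f) = b.+1 * size (bd (onF A f)).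
Proof.
case=> r [rs [fr rsP rE]].
by rewrite -(size_sbp fr) -(size_sbp rsP) -size_pow -rE size_map.
Qed.

Lemma size_bd_finv (K : surfaceComplex) (f : piece K) :
  size (bd (Defs.finv f)) = size (bd f).
Proof. by rewrite bd_finv size_rev size_map. Qed.

(** [k] - 1 is the common branching number of the pieces of the middle manifold
    over [fs]; as a factor of lengths it makes sense for both signs of [fs]. *)
Definition multiplicity (X : planarCovering) (fs : piece (base X)) k : Prop :=
  forall f0, onF (mid_cov X) f0 = fs -> size (bd f0) = k * size (bd fs).

Lemma multiplicity_base (X : planarCovering) (i : 'I_(nrel X)) :
  multiplicity (base_piece i) (mult i).
Proof.
move=> f0 f0i; rewrite (branching_size (mid_branching f0i)) f0i prednK //.
exact: mult_gt0.
Qed.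

(** Up to sign every base piece is some [base_piece i], and inverting a piece does
    not change the length of its boundary path. *)
Lemma multiplicity_ex (X : planarCovering) (fs : piece (base X)) :
  exists2 k, 0 < k & multiplicity fs k.
Proof.
have [posN _] := base_oriented X.
case: (boolp.EM (base_pos fs)) => [/base_pieceP [i ->] | npos].
  by exists (mult i); [exact: mult_gt0 | exact: multiplicity_base].
have /posN/base_pieceP [i iE] := npos.
exists (mult i) => [|f0 f0fs]; first exact: mult_gt0.
rewrite -size_bd_finv -(size_bd_finv fs) iE; apply: multiplicity_base.
by rewrite (cov_finv (mid_covering X)) f0fs.
Qed.

Lemma univ_covering (X : planarCovering) : covering (univ_cov X).
Proof. by case: (univ_universal X). Qed.

Lemma univ_boundary (X : planarCovering) (f : piece (univ X)) r :
  sbp f r -> sbp (onF (univ_cov X) f) (map (onS (univ_cov X)) r).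
Proof.
move=> fr; have [_ _ unbr _] := univ_universal X.
have [rs [rsP ->]] :=
  covering_boundary (univ_covering X) fr (branching_size (unbr f)).
by rewrite /pow /= cats0.
Qed.

Lemma total_star (X : planarCovering) : star_bijective (total_cov X).
Proof.
by apply: ccomp_star; apply: covering_star;
  [apply: mid_covering | apply: univ_covering].
Qed.

(** The base has a single point, so every sequence of its segments is a path. *)
Lemma lift_word (X : planarCovering) (p : Defs.point (univ X))
    (w : seq (seg (base X))) :
  exists r q, is_path p r q /\ map (onS (total_cov X)) r = w.
Proof.
have [o oP] := base_point X.
have Pw p' : is_path p' w o; last exact: star_path_lift (total_star X) (Pw _).
by elim: w p' => [|s w IH] p' /=; rewrite (oP p') //; split; [apply: oP | apply: IH].
Qed.

Lemma total_boundary (X : planarCovering) (f : piece (univ X)) r k :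
  multiplicity (onF (total_cov X) f) k -> sbp f r ->
  exists rs, sbp (onF (total_cov X) f) rs /\
    map (onS (total_cov X)) r = pow rs k.
Proof.
move=> mk /univ_boundary fr.
have [|rs [rsP rE]] := covering_boundary (mid_covering X) fr (k := k).
  exact: mk.
by exists rs; rewrite -rE -map_comp.
Qed.

(** The condition on lifted boundary paths for the composite covering, stated for
    a whole boundary path upstairs instead of an initial part [w1] lying over [rs]
    once.  The image of [w1] in the middle manifold selects a piece there, whose
    boundary path must be the full image of [w], since both have the same start
    and the same projection; as the universal covering is unbranched, [w] itself
    is then the boundary path of a piece above. *)
Lemma total_piece (X : planarCovering) (fs : piece (base X)) rs k
    (p q : Defs.point (univ X)) w :
  0 < k -> multiplicity fs k -> sbp fs rs -> is_path p w q ->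
  map (onS (total_cov X)) w = pow rs k ->
  exists! f, onF (total_cov X) f = fs /\ sbp f w.
Proof.
move=> k_gt0 mk rsP Pw wE.
have covU := univ_covering X; have covM := mid_covering X.
have starU := covering_star covU; have starM := covering_star covM.
have sz_rs := size_sbp rsP.
pose n := size rs; pose w1 := take n w; pose Aw := map (onS (univ_cov X)) w.
have BAw : map (onS (mid_cov X)) Aw = pow rs k by rewrite -map_comp.
have PAw : is_path _ Aw _ := star_path starU Pw.
pose Aw1 := take n Aw.
have BAw1 : map (onS (mid_cov X)) Aw1 = rs.
  by rewrite map_take BAw -(prednK k_gt0) [pow _ _]/(rs ++ _) take_size_cat.
have [m [PAw1 _]] : exists m, is_path (onP (univ_cov X) p) Aw1 m /\
    is_path m (drop n Aw) (onP (univ_cov X) q).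
  by apply/is_path_cat; rewrite cat_take_drop.
have [f0 [[f0fs [r0 [f0r0 pre]]] uniq_f0]] := cov_lift covM rsP PAw1 BAw1.
(* a boundary path which starts like the lifted path is all of it *)
have r0E : r0 = Aw.
  have [|rs' [rs'P r0E]] := covering_boundary covM f0r0 (k := k).
    by rewrite f0fs; apply: mk.
  rewrite f0fs in rs'P.
  have rs'E : rs' = rs.
    move: pre; rewrite prefixE => /eqP /(congr1 (map (onS (mid_cov X)))).
    rewrite BAw1 map_take r0E -(size_map (onS (mid_cov X))) BAw1.
    rewrite -(prednK k_gt0) [pow _ _]/(rs' ++ _) take_size_cat //.
    by rewrite sz_rs (size_sbp rs'P).
  have [p0 Pr0] := sbp_closed f0r0.
  apply: (@star_path_inj _ _ (mid_cov X) p0 _ p0 _ (onP (univ_cov X) q)) => //.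
    suff -> : p0 = onP (univ_cov X) p by [].
    case/prefixP: pre => r1 r0E1; move: Pr0 PAw1; rewrite r0E1.
    have: size Aw1 <> 0.
      by rewrite -(size_map (onS (mid_cov X))) BAw1 sz_rs; have := size_bd_gt0 fs; case: size.
    by case: (Aw1) => // s x _ /= [<- _] [<- _].
  by rewrite r0E rs'E.
rewrite r0E in f0r0.
have [f [[ff0 [r [fr pre_r]]] uniq_f]] := cov_lift covU f0r0 Pw erefl.
have over f' : onF (total_cov X) f' = fs -> sbp f' w -> onF (univ_cov X) f' = f0.
  move=> f'fs f'w; apply/esym/uniq_f0; split=> //.
  exists Aw; split; first exact: univ_boundary.
  by apply/prefixP; exists (drop n Aw); rewrite cat_take_drop.
exists f; split=> [|f' [f'fs f'w]]; last first.
  by apply: uniq_f; split; [apply: over | exists w; rewrite prefix_refl].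
split; first by rewrite /= ff0.
suff -> : w = r by [].
move: pre_r; rewrite prefixE => /eqP <-; rewrite take_oversize //.
rewrite -(size_map (onS (univ_cov X)) r) (size_sbp (univ_boundary fr)) ff0.
by rewrite -(size_sbp f0r0) size_map.
Qed.

(** * Left translations *)

Lemma vertex_surj (X : planarCovering) (p : Defs.point (univ X)) :
  exists x, vertex x = p.
Proof. by have [unv _ vK] := vertex_bij X; exists (unv p). Qed.

Lemma vertex_inj (X : planarCovering) : injective (@vertex X).
Proof. exact: bij_inj (vertex_bij X). Qed.

(** For an inverse letter, [vertexP] is applied to the opposite segment. *)
Lemma ter_vertex (X : planarCovering) (s : seg (univ X)) x a :
  ini s = vertex x ->
  onS (total_cov X) s = letter sinv (@base_seg X) a ->
  ter s = vertex (x * letter (fun g => g^-1) (@gen X) a)%g.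
Proof.
case: a => j [] sx; rewrite /letter /= => sj; last exact: vertexP sx sj.
have [y yE] := vertex_surj (ter s).
have sNj : onS (total_cov X) (sinv s) = base_seg j.
  by have [_ invT _] := total_star X; rewrite invT /= sj sinvK.
have := vertexP (esym yE) sNj.
by rewrite /ter sinvK sx -/(ter s) -yE => /vertex_inj ->; rewrite mulgK.
Qed.

Lemma path_vertex (X : planarCovering) x (r : seq (seg (univ X))) q w :
  is_path (vertex x) r q ->
  map (onS (total_cov X)) r = map (letter sinv (@base_seg X)) w ->
  q = vertex (x * eval (@gen X) w)%g.
Proof.
elim: r x w => [|s r IH] x [|a w] //= => [<- _ | [sx Pr] [sa rw]].
  by rewrite /eval big_nil mulg1.
rewrite (ter_vertex sx sa) in Pr.
by rewrite (IH _ _ Pr rw) /eval big_cons mulgA.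
Qed.

Lemma translate_seg_ex (X : planarCovering) (u : principal X)
    (s : seg (univ X)) :
  exists t, (forall x, ini s = vertex x -> ini t = vertex (u * x)%g) /\
    onS (total_cov X) t = onS (total_cov X) s.
Proof.
have [x xE] := vertex_surj (ini s).
have [[|t [|? ?]] [q [Pt /= tE]]] // := 
  lift_word (vertex (u * x)%g) [:: onS (total_cov X) s].
exists t; split=> [y|]; last by case: tE.
by rewrite -xE => /vertex_inj <-; case: Pt.
Qed.

(** Left multiplication by [u] on segments: the projection to the base is kept
    and the initial point is moved. *)
Definition translate_seg (X : planarCovering) (u : principal X)
    (s : seg (univ X)) : seg (univ X) :=
  projT1 (boolp.cid (translate_seg_ex u s)).

Lemma ini_translate (X : planarCovering) (u : principal X) s x :
  ini s = vertex x -> ini (translate_seg u s) = vertex (u * x)%g.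
Proof. by rewrite /translate_seg; case: boolp.cid => t /= [tP _]; apply: tP. Qed.

Lemma total_translate (X : planarCovering) (u : principal X) s :
  onS (total_cov X) (translate_seg u s) = onS (total_cov X) s.
Proof. by rewrite /translate_seg; case: boolp.cid => t /= [_ tP]; apply: tP. Qed.

Lemma translate_segP (X : planarCovering) (u : principal X) s t x :
  ini s = vertex x -> ini t = vertex (u * x)%g ->
  onS (total_cov X) t = onS (total_cov X) s -> translate_seg u s = t.
Proof.
move=> sx tx ts; apply: star_inj (total_star X) _ _.
  by rewrite tx; apply: ini_translate.
by rewrite ts total_translate.
Qed.

Lemma translate_segK (X : planarCovering) (u : principal X) :
  cancel (translate_seg u) (translate_seg u^-1).
Proof.
move=> s; have [x /esym sx] := vertex_surj (ini s).
apply: translate_segP (ini_translate u sx) _ _; first by rewrite mulKg.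
by rewrite total_translate.
Qed.

(** Final points are obtained by right multiplication with a generator, which
    commutes with left multiplication by [u]. *)
Lemma ter_translate (X : planarCovering) (u : principal X) s x :
  ter s = vertex x -> ter (translate_seg u s) = vertex (u * x)%g.
Proof.
move=> sx; have [y /esym sy] := vertex_surj (ini s).
have [unl _ lK] := base_segP X.
have sa := esym (lK (onS (total_cov X) s)).
rewrite (ter_vertex (ini_translate u sy) (etrans (total_translate u s) sa)).
by move: sx; rewrite (ter_vertex sy sa) => /vertex_inj <-; rewrite mulgA.
Qed.

Lemma translate_sinv (X : planarCovering) (u : principal X) s :
  translate_seg u (sinv s) = sinv (translate_seg u s).
Proof.
have [x /esym sx] := vertex_surj (ter s).
apply: translate_segP (sx) _ _; first exact: (ter_translate u sx).
by have [_ invT _] := total_star X; rewrite !invT total_translate.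
Qed.

Lemma translate_path (X : planarCovering) (u : principal X) x w y :
  is_path (vertex x) w (vertex y) ->
  is_path (vertex (u * x)) (map (translate_seg u) w) (vertex (u * y)).
Proof.
elim: w x => [|s w IH] x /=; first by move/vertex_inj->.
have [z /esym sz] := vertex_surj (ter s).
case=> sx; rewrite sz => /IH Pw.
split; first exact: ini_translate.
by rewrite (ter_translate u sz).
Qed.

Lemma piece_uniq (X : planarCovering) (f h : piece (univ X)) w :
  onF (total_cov X) f = onF (total_cov X) h -> sbp f w -> sbp h w -> f = h.
Proof.
move=> fh fw hw; have [k k_gt0 mk] := multiplicity_ex (onF (total_cov X) h).
have [rs [rsP wE]] := total_boundary mk hw.
have [p Pw] := sbp_closed hw.
have [x [_ uniq_x]] := total_piece k_gt0 mk rsP Pw wE.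
by rewrite -(uniq_x f) // -(uniq_x h).
Qed.

Lemma translate_piece_ex (X : planarCovering) (u : principal X)
    (f : piece (univ X)) :
  exists h, onF (total_cov X) h = onF (total_cov X) f /\
    sbp h (map (translate_seg u) (bd f)).
Proof.
have [k k_gt0 mk] := multiplicity_ex (onF (total_cov X) f).
have [rs [rsP wE]] := total_boundary mk (sbp_bd f).
have [p Pf] := bd_closed f; have [x xE] := vertex_surj p.
rewrite -xE in Pf; have Puf := translate_path u Pf.
have [|h [hP _]] := total_piece k_gt0 mk rsP Puf; last by exists h.
by rewrite -wE -map_comp; apply: eq_map => s; apply: total_translate.
Qed.

Definition translate_piece (X : planarCovering) (u : principal X)
    (f : piece (univ X)) : piece (univ X) :=
  projT1 (boolp.cid (translate_piece_ex u f)).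

Lemma total_translate_piece (X : planarCovering) (u : principal X) f :
  onF (total_cov X) (translate_piece u f) = onF (total_cov X) f.
Proof. by rewrite /translate_piece; case: boolp.cid => h /= []. Qed.

Lemma translate_sbp (X : planarCovering) (u : principal X) f r :
  sbp f r -> sbp (translate_piece u f) (map (translate_seg u) r).
Proof.
case=> n ->; rewrite map_rot; apply: sbp_rot.
by rewrite /translate_piece; case: boolp.cid => h /= [].
Qed.

Lemma translate_pieceP (X : planarCovering) (u : principal X) f h r :
  onF (total_cov X) h = onF (total_cov X) f ->
  sbp f r -> sbp h (map (translate_seg u) r) -> translate_piece u f = h.
Proof.
move=> hf fr hr; apply: piece_uniq (translate_sbp u fr) hr.
by rewrite total_translate_piece.
Qed.

Lemma translate_pieceK (X : planarCovering) (u : principal X) :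
  cancel (translate_piece u) (translate_piece u^-1).
Proof.
move=> f; apply: translate_pieceP (translate_sbp u (sbp_bd f)) _.
  by rewrite total_translate_piece.
by rewrite -map_comp (eq_map (translate_segK u)) map_id; apply: sbp_bd.
Qed.

Lemma translate_finv (X : planarCovering) (u : principal X) f :
  translate_piece u (Defs.finv f) = Defs.finv (translate_piece u f).
Proof.
have finvT h : onF (total_cov X) (Defs.finv h) = Defs.finv (onF (total_cov X) h).
  by rewrite /= (cov_finv (univ_covering X)) (cov_finv (mid_covering X)).
apply: translate_pieceP (sbp_finv (sbp_bd f)) _.
  by rewrite !finvT total_translate_piece.
have := sbp_finv (translate_sbp u (sbp_bd f)).
rewrite map_rev -!map_comp; congr (sbp _ (rev _)).
by apply: eq_map => s /=; rewrite translate_sinv.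
Qed.

Lemma left_translation_ex (X : planarCovering) (u : principal X) :
  exists g, left_translation u g.
Proof.
have [unv unvK vK] := vertex_bij X.
pose tp u' p := vertex (u' * unv p)%g.
have tpK u' : cancel (tp u') (tp u'^-1%g).
  by move=> p; rewrite /tp unvK mulKg vK.
have bij T (t : principal X -> T -> T) :
    (forall u', cancel (t u') (t u'^-1%g)) -> bijective (t u).
  by move=> tK; exists (t u^-1%g); [apply: tK | rewrite -{2}(invgK u); apply: tK].
exists (CMap (tp u) (translate_seg u) (translate_piece u)).
split=> [|v|s|f].
- split=> /=.
  + exact: bij.
  + exact: bij (@translate_segK X).
  + exact: bij (@translate_pieceK X).
  + by move=> s; apply: ini_translate; rewrite vK.
  + exact: translate_sinv.
  + exact: translate_finv.
  + exact: translate_sbp.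
- by rewrite /= /tp unvK.
- exact: total_translate.
- exact: total_translate_piece.
Qed.

(** * Orientation of the quotient *)

Lemma orientation_uniq (K : surfaceComplex) (pos : piece K -> Prop) f :
  orientation pos -> pos f -> uniq (bd f).
Proof.
move=> [_ oriS] posf; have: 0 < size (bd f) by apply: size_bd_gt0.
case fE: (bd f) => [//|s0 w] _; rewrite -fE.
have seg_at j : j < size (bd f) -> passage_seg (f, j) = Some (nth s0 (bd f) j).
  by move=> ltj; rewrite /passage_seg onthE (nth_map s0).
apply/(uniqP s0) => j j' ltj ltj' eqj.
have [c [_ uniq_c]] := oriS (nth s0 (bd f) j).
have cj : c = (f, j) by apply: uniq_c; split=> //; apply: seg_at.
have cj' : c = (f, j') by apply: uniq_c; split=> //; rewrite eqj; apply: seg_at.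
by move: cj'; rewrite cj => -[].
Qed.

Lemma mem_pow (T : eqType) (x : T) w k : x \in pow w k -> x \in w.
Proof. by case/flattenP=> w' /nseqP[-> _]. Qed.

Lemma covering_mem (K L : surfaceComplex) (A : cmap K L) s f :
  covering A -> s \in bd f -> onS A s \in bd (onF A f).
Proof.
move=> covA sf; have [rs [ws [rsP rE _ _ _]]] := cov_bd covA (sbp_bd f).
by rewrite -(mem_sbp rsP) (@mem_pow _ _ _ (size ws)) // -rE map_f.
Qed.

Lemma covering_mem_ex (K L : surfaceComplex) (A : cmap K L) t f :
  covering A -> t \in bd (onF A f) -> exists2 s, s \in bd f & onS A s = t.
Proof.
move=> covA tf; have [rs [ws [rsP rE fE _ _]]] := cov_bd covA (sbp_bd f).
suff: t \in map (onS A) (bd f) by case/mapP=> s sf ->; exists s.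
have: 0 < size ws by have := size_bd_gt0 f; rewrite fE; case: ws {rE fE}.
rewrite rE; case: (size ws) => // k _.
by rewrite [pow _ _]/(rs ++ _) mem_cat (mem_sbp rsP) tf.
Qed.

Lemma runs_count (K : surfaceComplex) (s : seg K) w :
  runs s w = count_mem s w + count_mem (sinv s) w.
Proof.
rewrite -count_predUI [X in _ + X](_ : _ = 0) ?addn0 //.
rewrite (@eq_count _ _ pred0) ?count_pred0 // => t /=.
by case: eqP => //= ->; apply/eqP => /esym; apply: sinv_neq.
Qed.

(** Lift a positive base piece which runs through the segment below [s]. *)
Lemma positive_piece_through (X : planarCovering) (s : seg (univ X)) :
  exists h, base_pos (onF (total_cov X) h) /\ s \in bd h.
Proof.
have [_ oriS] := base_oriented X.
have [[fs j] [[/= pos_fs fsj] _]] := oriS (onS (total_cov X) s).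
have: onS (total_cov X) s \in bd fs.
  move: fsj; rewrite /passage_seg onthE /=.
  have [ltj | gej] := ltnP j (size (bd fs)); last by rewrite nth_default ?size_map.
  by rewrite (nth_map (onS (total_cov X) s)) // => -[] <-; apply: mem_nth.
case/rot_to=> n rs rsE; have [k k_gt0 mk] := multiplicity_ex fs.
have rsP : sbp fs (onS (total_cov X) s :: rs) by exists n.
have [w [q [Pw wE]]] :=
  lift_word (ini s) (pow (onS (total_cov X) s :: rs) k).
have [h [[hfs hw] _]] := total_piece k_gt0 mk rsP Pw wE.
exists h; split; first by move: pos_fs; rewrite -hfs.
rewrite -(mem_sbp hw).
move: wE Pw; rewrite -(prednK k_gt0).
case: w {hw} => // t w [ts _] [t_ini _].
by rewrite (star_inj (total_star X) t_ini ts) mem_head.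
Qed.

(** M is oriented by the images of the pieces over positive base pieces.  If the
    image of [f] ran through [s] twice in the same direction, it would be, up to
    orientation, the only piece at [s], with no passage through the inverse of [s].
    But some positive piece [h] runs through this inverse: its image is then the
    inverse of the image of [f], and as pieces with the same image in M lie over
    the same base piece, a positive base piece would have a positive inverse. *)
Lemma quotient_boundary_uniq (X : planarCovering) (U : set (principal X))
    (M : surfaceComplex) (A : cmap (univ X) M) f :
  belongs_to U A -> base_pos (onF (total_cov X) f) -> uniq (bd (onF A f)).
Proof.
move=> [manM [covA _] _ _ fibF] pos_f.
apply: count_mem_uniq => s; apply/eqP; rewrite eqn_leq.
have [sf | /count_memPn-> //] := boolP (s \in bd (onF A f)).
rewrite andbC -has_count has_pred1 sf leqNgt; apply/negP => twice.
have := manifold_le2 manM s (onF A f); rewrite runs_count => le2.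
have s'0 : count_mem (sinv s) (bd (onF A f)) = 0.
  by apply/eqP; rewrite -leqn0 -(leq_add2l 2) (leq_trans _ le2) ?leq_add2r.
have run2 : runs s (bd (onF A f)) = 2.
  by apply/eqP; rewrite runs_count eqn_leq le2 s'0 addn0.
have [t tf ts] := covering_mem_ex covA sf.
have [h [pos_h th]] := positive_piece_through (sinv t).
have s'h : sinv s \in bd (onF A h).
  by rewrite -ts -(cov_sinv covA); apply: covering_mem.
have run_h : 0 < runs s (bd (onF A h)).
  by rewrite runs_count addn_gt0 -!has_count !has_pred1 s'h orbT.
case: (manifold_twice manM run2 run_h) => hf.
  by move: s'h; rewrite hf -has_pred1 has_count s'0.
have [posN _] := base_oriented X.
move: hf; rewrite -(cov_finv covA) => /fibF[g [u _ [_ _ _ gF]] gh].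
have := gF h; rewrite gh => finvE.
have := posN (onF (total_cov X) f); case=> + _; apply=> //.
move: pos_h; rewrite -finvE /=.
by rewrite (cov_finv (univ_covering X)) (cov_finv (mid_covering X)).
Qed.

(** * Cosets along the boundary path *)

Lemma right_coset_eq (G : groupType) (U : set G) v x :
  is_subgroup U ->
  right_coset U (v * x)%g = right_coset U v <-> U (v * x / v)%g.
Proof.
move=> [U1 Ud].
have UV u : U u -> U u^-1%g by move=> Uu; rewrite -[u^-1%g]mul1g; apply: Ud.
have UM a b : U a -> U b -> U (a * b)%g.
  by move=> Ua Ub; rewrite -[b]invgK; apply: Ud => //; apply: UV.
split=> [cosE | Ux].
  have : right_coset U (v * x)%g (v * x)%g by exists 1%g; rewrite ?mul1g.
  by rewrite cosE => -[u Uu <-]; rewrite mulgK.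
apply/seteqP; split=> _ [u Uu <-].
  by exists (u * (v * x / v))%g; [apply: UM | rewrite -!mulgA mulVg mulg1].
exists (u * (v * x / v)^-1)%g; first by apply/UM/UV.
by rewrite -mulgA invgF -mulgA mulVg mulg1.
Qed.

(** The exponents j with v x^j v^-1 in U are closed under division with
    remainder, since v x^j v^-1 is the j-th power of the conjugate y of x. *)
Lemma subgroup_period (G : groupType) (U : set G) v x l k :
  is_subgroup U -> 0 < l -> U (v * x ^+ l / v)%g ->
  (forall l', 0 < l' -> U (v * x ^+ l' / v)%g -> l <= l') ->
  (x ^+ k)%g = 1%g -> l %| k.
Proof.
move=> [U1 Ud] l_gt0; pose y := (x ^ v^-1)%g.
have yE j : (v * x ^+ j / v)%g = (y ^+ j)%g.
  by rewrite -conjXg conjgE invgK mulgA.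
rewrite yE => Ul minl xk1.
have UM a b : U a -> U b -> U (a * b)%g.
  by move=> Ua Ub; rewrite -[b]invgK -[(b^-1)%g]mul1g; apply/Ud/Ud.
have Uq q : U (y ^+ (q * l))%g.
  by elim: q => [|q IH]; rewrite ?expg0 // mulSn expgnDr; apply: UM.
have Urem : U (y ^+ (k %% l))%g.
  have: (y ^+ k = 1)%g by rewrite -yE xk1 mulg1 mulgV.
  rewrite {1}(divn_eq k l) expgnDr => /mulg1_eq <-.
  by rewrite -[(_^-1)%g]mul1g; apply: Ud.
rewrite /dvdn -leqn0 leqNgt; apply/negP => rem_gt0.
by have := minl _ rem_gt0; rewrite yE leqNgt ltn_mod l_gt0 => /(_ Urem).
Qed.

Lemma ini_nth_pow (X : planarCovering) x (r : seq (seg (univ X))) q w k j s0 :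
  is_path (vertex x) r q ->
  map (onS (total_cov X)) r = map (letter sinv (@base_seg X)) (pow w k) ->
  j < k -> 0 < size w ->
  ini (nth s0 r (j * size w)) = vertex (x * eval (@gen X) w ^+ j)%g.
Proof.
move=> Pr rE lt_jk w_gt0.
have lt_jr : j * size w < size r.
  by rewrite -(size_map (onS (total_cov X))) rE size_map size_pow ltn_pmul2r.
move: Pr; rewrite -{1}(cat_take_drop (j * size w) r) (drop_nth s0 lt_jr).
case/is_path_cat=> p [Pp /is_path_ini ->].
rewrite -eval_pow; apply: path_vertex Pp _.
by rewrite map_take rE (pow_split w (ltnW lt_jk)) -map_take -size_pow take_size_cat.
Qed.

Theorem mainTheorem8 (X : planarCovering) (U : set (principal X))
    (M : surfaceComplex) (A' : cmap (univ X) M) (i : 'I_(nrel X))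
    (v : principal X) (l : nat) :
  is_subgroup U ->
  belongs_to U A' ->
  let R := eval (@gen X) (relator i) in
  let k := mult i in
  0 < l ->
  right_coset U (v * R ^+ l)%g = right_coset U v ->
  (forall l', 0 < l' ->
     right_coset U (v * R ^+ l')%g = right_coset U v -> l <= l') ->
  l %| k /\
  forall m, k = l * m ->
    exists r, spells (vertex v) (pow (relator i) k) r /\
      exists f r', onF (total_cov X) f = base_piece i /\
        covers_with_order A' f r r' m.-1.
Proof.
move=> subU belU R k l_gt0 /(right_coset_eq _ _ subU) Ul minl0.
have minl l' : 0 < l' -> U (v * R ^+ l' / v)%g -> l <= l'.
  by move=> l'_gt0 /(right_coset_eq _ _ subU); apply: minl0.
have Rk1 : (R ^+ k = 1)%g.
  have [_ relP] := principalP X.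
  have -> : 1%g = eval (@gen X) [::] by rewrite /eval big_nil.
  rewrite -eval_pow; apply/relP/word_equiv_sym.
  have := @word_equiv_rel _ (fun w => exists i, w = pow (relator i) (mult i))
    [::] [::] (pow (relator i) k).
  by rewrite /= cats0; apply; exists i.
have l_dvd_k := subgroup_period subU l_gt0 Ul minl Rk1.
split=> // m km; have k_gt0 : 0 < k := mult_gt0 i.
pose Rs := map (letter sinv (@base_seg X)) (relator i); pose n := size (relator i).
have RsP : sbp (base_piece i) Rs := relatorP i.
have szRs : size Rs = n by rewrite size_map.
have uniqRs : uniq Rs.
  case: (RsP) => j ->; rewrite rot_uniq.
  by apply: orientation_uniq (base_oriented X) _; apply/base_pieceP; exists i.
have n_gt0 : 0 < n by rewrite -szRs (size_sbp RsP) size_bd_gt0.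
have [r [q [Pr rE]]] := lift_word (vertex v)
  (map (letter sinv (@base_seg X)) (pow (relator i) k)).
have rRs : map (onS (total_cov X)) r = pow Rs k by rewrite rE map_pow.
have [f [[fi fr] _]] := total_piece k_gt0 (@multiplicity_base X i) RsP Pr rRs.
exists r; split; first by split=> //; exists q.
have [_ [covA _] _ fibS _] := belU.
have [rs [ws [rsP rsE _ _ _]]] := cov_bd covA fr.
exists f, rs; split=> //; split=> //; rewrite rsE; congr (pow _ _).
have uniq_rs : uniq rs.
  case: (rsP) => j ->; rewrite rot_uniq; apply: quotient_boundary_uniq belU _.
  by rewrite fi; apply/base_pieceP; exists i.
have rs_gt0 : 0 < size rs by rewrite (size_sbp rsP) size_bd_gt0.
have szr : size r = k * n by rewrite -szRs -size_pow -rRs size_map.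
have szE : k * n = size ws * size rs by rewrite -size_pow -rsE size_map.
have ws_gt0 : 0 < size ws.
  by move: (muln_gt0 k n); rewrite szE k_gt0 n_gt0 muln_gt0 => /andP[].
have r_gt0 : 0 < size r by rewrite szr muln_gt0 k_gt0.
have [s0 _] : exists s0, s0 \in r by case: (r) r_gt0 => // s0 r0 _; exists s0; rewrite mem_head.
have ini_r j : j < k -> ini (nth s0 r (j * n)) = vertex (v * R ^+ j)%g.
  by move=> ltjk; apply: ini_nth_pow Pr rE ltjk n_gt0.
have ini_r0 : ini (nth s0 r 0) = vertex v.
  by rewrite -(mul0n n) ini_r // expg0 mulg1.
have total_r j : j < k * n ->
    onS (total_cov X) (nth s0 r j) = nth (onS (total_cov X) s0) Rs (j %% n).
  by move=> ltj; rewrite -(nth_map _ (onS (total_cov X) s0)) ?szr // rRs nth_pow szRs.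
have quot_r j : j < k * n ->
    onS A' (nth s0 r j) = nth (onS A' s0) rs (j %% size rs).
  by move=> ltj; rewrite -(nth_map _ (onS A' s0)) ?szr // rsE nth_pow -?szE.
(* If rs is the whole image of r, then j = k and R^k = 1; otherwise the segment
   of r at position [size rs] exists and has the same image as the initial one. *)
have [j jn Uj] : exists2 j, size rs = j * n & U (v * R ^+ j / v)%g.
  have [ws1 | ws1] := leqP (size ws) 1.
    exists k; last by rewrite Rk1 mulg1 mulgV; case: subU.
    by rewrite szE (_ : size ws = 1) ?mul1n //; apply/eqP; rewrite eqn_leq ws1.
  have lt_rs : size rs < k * n by rewrite szE -{1}[size rs]mul1n ltn_pmul2r.
  have: onS A' (nth s0 r 0) = onS A' (nth s0 r (size rs)).
    by rewrite !quot_r ?(leq_trans _ lt_rs) // modnn mod0n.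
  case/fibS=> g [u Uu [autg gp gS _]] gr.
  have n_dvd : size rs %% n = 0.
    have := gS (nth s0 r 0); rewrite gr !total_r ?(leq_trans _ lt_rs) // mod0n.
    by move/eqP; rewrite nth_uniq ?szRs ?ltn_mod // => /eqP.
  have [j jn] : exists j, size rs = j * n.
    by exists (size rs %/ n); rewrite {1}(divn_eq (size rs) n) n_dvd addn0.
  exists j => //; have := aut_ini autg (nth s0 r 0).
  rewrite gr ini_r0 gp jn ini_r; last by rewrite -(ltn_pmul2r n_gt0) -jn.
  by move/vertex_inj->; rewrite mulgK.
have j_gt0 : 0 < j by case: (j) jn => // jn; rewrite jn in rs_gt0.
suff jl : j = l.
  apply/eqP; rewrite -(eqn_pmul2r rs_gt0) -szE jn jl km prednK; last first.
    by move: k_gt0; rewrite km; case: (m) => //; rewrite muln0.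
  by rewrite mulnCA mulnA.
apply/eqP; rewrite eqn_leq minl // andbT leqNgt; apply/negP => lt_lj.
have lt_ln : l * n < size rs by rewrite jn ltn_pmul2r.
have le_rs : size rs <= k * n by rewrite szE leq_pmull.
have lt_lk : l < k by rewrite -(ltn_pmul2r n_gt0) (leq_trans lt_ln).
(* The translation by v R^l v^-1 now makes rs repeat a segment at position l * n. *)
have [g transg] := left_translation_ex (v * R ^+ l / v)%g.
have [autg gp gS _] := transg.
have gr : onS g (nth s0 r 0) = nth s0 r (l * n).
  apply: star_inj (total_star X) _ _.
    by rewrite (aut_ini autg) ini_r0 gp ini_r // mulgVK.
  by rewrite gS !total_r ?ltn_pmul2r ?muln_gt0 ?k_gt0 // modnMl mod0n.
have: onS A' (nth s0 r 0) = onS A' (nth s0 r (l * n)).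
  by apply/fibS; exists g => //; exists (v * R ^+ l / v)%g.
rewrite !quot_r ?ltn_pmul2r ?muln_gt0 ?k_gt0 // mod0n modn_small // => /eqP.
by rewrite nth_uniq // eq_sym muln_eq0 !eqn0Ngt l_gt0 n_gt0.
Qed.
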